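(* For every real $t$ with $-1\le t\le 1$, $$\sum_{n=1}^\infty H_n\,\frac{t^{n+1}}{(n+1)^2}=\operatorname{Li}_3\!\left(\frac{-t}{1-t}\right)-\frac16\log^3(1-t)-\log(1-t)\,\operatorname{Li}_2(t)+\operatorname{Li}_3(t),$$ where for $t=1$ the right-hand side is understood as its limit as $t\to1^-$.
   Context: $H_n=1+\frac12+\cdots+\frac1n$ denotes the $n$-th harmonic number, and $\log$ is the real natural logarithm. For real $s$ with $|s|\le1$, $\operatorname{Li}_2(s)=\sum_{n\ge1} s^n/n^2$ and $\operatorname{Li}_3(s)=\sum_{n\ge1}s^n/n^3$. For real $s<-1$ (which occurs as the argument $\frac{-t}{1-t}$ when $\frac12<t<1$), $\operatorname{Li}_3(s)$ is the extension given by $\operatorname{Li}_3(s)=\int_0^s \frac{\operatorname{Li}_2(u)}{u}\,du$ with $\operatorname{Li}_2(u)=-\int_0^u\frac{\log(1-v)}{v}\,dv$. Equivalently, for $0<t<1$ it is given by Landen's identity $\operatorname{Li}_3\!\left(\frac{-t}{1-t}\right)=\frac16\log^3(1-t)-\operatorname{Li}_3(1-t)-\frac12\log(t)\log^2(1-t)+\frac{\pi^2}{6}\log(1-t)-\operatorname{Li}_3(t)+\zeta(3)$. *)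

(* Defs.v *)
From Stdlib Require Import Reals.
From Coquelicot Require Import Coquelicot.
Open Scope R_scope.

Definition harmonic (n : nat) : R := sum_n_m (fun k : nat => / INR k) 1 n.

(* The integrands below have a removable singularity at 0; their value there
   is irrelevant to the Riemann integral.  [RInt] with bounds [0] and [s] is
   the oriented integral, also when [s < 0]. *)
Definition Li2_integral (u : R) : R := - RInt (fun v : R => ln (1 - v) / v) 0 u.

Definition Li3_integral (s : R) : R := RInt (fun u : R => Li2_integral u / u) 0 s.

(* Polylogarithms on the real half-line [s <= 1]: the power series for
   [|s| <= 1] (the term of index [n] is the one in [s ^ (n + 1)]), and the
   integral extension for [s < -1].  The values for [s > 1] are meaningless. *)
Definition Li2 (s : R) : R :=
  if Rle_dec (Rabs s) 1
  then Series (fun n : nat => s ^ (n + 1) / INR (n + 1) ^ 2)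
  else Li2_integral s.

Definition Li3 (s : R) : R :=
  if Rle_dec (Rabs s) 1
  then Series (fun n : nat => s ^ (n + 1) / INR (n + 1) ^ 3)
  else Li3_integral s.

(* Main.v *)
Require Import Defs.
From Stdlib Require Import Reals Lra Lia.
From Coquelicot Require Import Coquelicot.
Open Scope R_scope.

(** The series [S(t) = sum H_n t^(n+1) / (n+1)^2] converges normally on
    [[-1, 1]], so it is continuous there, and on [(-1, 1)] it satisfies
    [t S'(t) = sum H_n t^(n+1) / (n+1) = ln(1-t)^2 / 2].  The second equality
    is itself obtained by differentiating, from [sum H_n t^n = - ln(1-t) / (1-t)]
    ([PSeries_harmonic], [PSeries_harmonic_coeff_1]).

    The right-hand side has the same derivative ([is_derive_harmonic_sum_rhs]).
    With [y = - t / (1-t)] one has [dy/y = dt / (t (1-t))], so the derivative of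
    [Li3 y] is [Li2 y / (t (1-t))], and Landen's identity
    [Li2 y = - Li2 t - ln(1-t)^2 / 2] ([landen_Li2]) makes all dilogarithms
    cancel.  Both sides vanish at [0] and are continuous on [[-1, 1)], so they
    agree there ([PSeries_harmonic_coeff_2]).  The limit at [1] then exists
    because [S] is continuous at [1].

    Two points need care.  First, for [t > 1/2] the argument [y] runs below
    [-1], where [Li3] switches from a power series to an iterated integral.  The
    integrals are therefore taken as the primary functions on [(-oo, 1)], where
    they are differentiable ([is_derive_RInt_quotient]), and are shown to agree
    with the series on [[-1, 1)] ([Li2_eq_integral], [Li3_eq_integral]).  Second,
    the endpoints [-1] and [1] lie on the boundary of the disk of convergence;
    precomposing a normally convergent power series with the retraction [clamp]
    of the line onto [[-1, 1]] gives an everywhere continuous function, so that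
    the usual two-sided continuity lemmas apply. *)

(** * Functions with equal derivatives *)

(** Mean value theorem for [F - G].  The derivatives are compared only strictly
    between [a] and [b]; with [a = 0] this leaves out [0], the point where quotients such as
    [ln (1 - x) / x] carry an arbitrary value. *)
Lemma eq_of_equal_derivatives (F G df : R -> R) (a b : R) :
  (forall x, Rmin a b < x < Rmax a b ->
     is_derive F x (df x) /\ is_derive G x (df x)) ->
  (forall x, Rmin a b <= x <= Rmax a b -> continuous F x /\ continuous G x) ->
  F a = G a -> F b = G b.
Proof.
  intros Hd Hc Ha.
  destruct (MVT_gen (fun x => F x - G x) a b (fun _ => 0)) as [c [_ Hc']].
  - intros x Hx. destruct (Hd x Hx) as [HF HG].
    replace 0 with (minus (df x) (df x)) by (unfold minus, plus, opp; simpl; ring).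
    apply (is_derive_minus F G x (df x) (df x)); assumption.
  - intros x Hx. destruct (Hc x Hx) as [HF HG].
    apply continuity_pt_filterlim.
    apply (continuous_minus F G x); assumption.
  - lra.
Qed.

(** * Normally convergent series *)

Lemma ex_series_of_telescoping (a u : nat -> R) :
  (forall n, 0 <= a n <= u n - u (S n)) -> (forall n, 0 <= u n) ->
  ex_series a.
Proof.
  intros Ha Hu.
  apply (ex_finite_lim_seq_incr (sum_n a) (u O)).
  - intros n. rewrite sum_Sn. change (sum_n a n <= sum_n a n + a (S n)).
    assert (H := Ha (S n)). lra.
  - assert (H : forall n, sum_n a n <= u O - u (S n)).
    { induction n as [|n IH].
      - rewrite sum_O. apply Ha.
      - rewrite sum_Sn. change (sum_n a n + a (S n) <= u O - u (S (S n))).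
        assert (H := Ha (S n)). lra. }
    intros n. assert (H1 := H n). assert (H2 := Hu (S n)). lra.
Qed.

(** Weierstrass M-test: the remainder after [n] terms is bounded, uniformly in
    the variable, by the remainder of the dominating series. *)
Lemma continuous_Series_of_dominated (f : nat -> R -> R) (M : nat -> R) :
  ex_series M ->
  (forall n x, Rabs (f n x) <= M n) ->
  (forall n x, continuous (f n) x) ->
  forall x, continuous (fun y => Series (fun n => f n y)) x.
Proof.
  intros HM Hf Hc x.
  assert (Hex : forall y, ex_series (fun n => f n y)).
  { intros y. apply (ex_series_le (fun n => f n y) M); [|exact HM].
    intros n. exact (Hf n y). }
  apply continuity_pt_filterlim.
  apply (CVU_cont_open (fun n y => sum_n (fun k => f k y) n) (fun _ => True)).
  - exact open_true.
  - intros eps.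
    assert (Hlim : is_series M (Series M)) by (apply Series_correct; exact HM).
    destruct (Hlim (ball (Series M) eps) (locally_ball _ eps)) as [N HN].
    exists (S N). intros n Hn y _.
    change (Rabs (sum_n (fun k => f k y) n - Series (fun k => f k y)) < eps).
    assert (HN' := HN n ltac:(lia)).
    change (Rabs (sum_n M n - Series M) < eps) in HN'.
    assert (HMn : Series M = sum_n M n + Series (fun k => M (S n + k)%nat)).
    { rewrite (Series_incr_n M (S n)); [|lia|exact HM].
      simpl pred. now rewrite sum_n_Reals. }
    assert (Hfn : Series (fun k => f k y) =
       sum_n (fun k => f k y) n + Series (fun k => f (S n + k)%nat y)).
    { rewrite (Series_incr_n (fun k => f k y) (S n)); [|lia|apply Hex].
      simpl pred. now rewrite sum_n_Reals. }
    assert (HMt : ex_series (fun k => M (S n + k)%nat))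
      by (apply (ex_series_incr_n M (S n)); exact HM).
    assert (Hle : Rabs (Series (fun k => f (S n + k)%nat y))
                  <= Series (fun k => M (S n + k)%nat)).
    { eapply Rle_trans; [apply Series_Rabs|apply Series_le].
      - apply (ex_series_le (fun k => Rabs (f (S n + k)%nat y))
                 (fun k => M (S n + k)%nat)); [|exact HMt].
        intros k. unfold norm; simpl. unfold abs; simpl.
        rewrite Rabs_Rabsolu. apply Hf.
      - intros k. split; [apply Rabs_pos|apply Hf].
      - exact HMt. }
    apply Rabs_def2 in HN'.
    rewrite Hfn.
    replace (_ - _) with (- Series (fun k => f (S n + k)%nat y)) by ring.
    rewrite Rabs_Ropp. lra.
  - intros n y _. apply continuity_pt_filterlim.
    induction n as [|n IH].
    + apply (continuous_ext (f O)); [|apply Hc].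
      intros z. now rewrite sum_O.
    + apply (continuous_ext
        (fun z => plus (sum_n (fun k => f k z) n) (f (S n) z))).
      * intros z. now rewrite sum_Sn.
      * apply (continuous_plus (fun z => sum_n (fun k => f k z) n) (f (S n)));
          [exact IH|apply Hc].
  - exact I.
Qed.

Definition clamp (x : R) : R := Rmax (-1) (Rmin 1 x).

Lemma clamp_id (x : R) : -1 <= x <= 1 -> clamp x = x.
Proof. intros H. unfold clamp. rewrite Rmin_right, Rmax_right; lra. Qed.

Lemma Rabs_clamp (x : R) : Rabs (clamp x) <= 1.
Proof.
  unfold clamp. apply Rabs_le. split; [apply Rmax_l|].
  apply Rmax_lub; [lra|apply Rmin_l].
Qed.

Lemma continuous_clamp (x : R) : continuous clamp x.
Proof.
  intros P [eps HP]. exists eps. intros y Hy. apply HP.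
  change (Rabs (y - x) < eps) in Hy.
  change (Rabs (clamp y - clamp x) < eps).
  apply Rabs_def2 in Hy. assert (He := cond_pos eps).
  unfold clamp, Rmax, Rmin.
  destruct (Rle_dec 1 y), (Rle_dec 1 x); apply Rabs_def1;
    repeat match goal with |- context [Rle_dec ?a ?b] =>
      destruct (Rle_dec a b) end; lra.
Qed.

Lemma pow_Rabs_le_1 (x : R) (n : nat) : Rabs x <= 1 -> Rabs (x ^ n) <= 1.
Proof.
  intros H. rewrite <- RPow_abs. rewrite <- (pow1 n).
  apply pow_incr. split; [apply Rabs_pos|exact H].
Qed.

Lemma ex_series_PSeries_closed (a : nat -> R) (x : R) :
  ex_series (fun n => Rabs (a n)) -> Rabs x <= 1 ->
  ex_series (fun n => a n * x ^ n).
Proof.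
  intros Ha Hx. refine (ex_series_le _ _ _ Ha). intros n.
  unfold norm; simpl; unfold abs; simpl. rewrite Rabs_mult.
  assert (H1 := pow_Rabs_le_1 x n Hx). assert (H2 := Rabs_pos (a n)).
  nra.
Qed.

Lemma continuous_PSeries_clamp (a : nat -> R) :
  ex_series (fun n => Rabs (a n)) ->
  forall x, continuous (fun y => PSeries a (clamp y)) x.
Proof.
  intros Ha.
  apply (continuous_Series_of_dominated (fun n y => a n * clamp y ^ n) _ Ha).
  - intros n x. rewrite Rabs_mult.
    assert (H1 := pow_Rabs_le_1 _ n (Rabs_clamp x)).
    assert (H2 := Rabs_pos (a n)). nra.
  - intros n x.
    apply (continuous_mult (fun _ => a n) (fun y => clamp y ^ n));
      [apply continuous_const|].
    apply (continuous_comp clamp (fun y => y ^ n)); [apply continuous_clamp|].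
    apply continuity_pt_filterlim, derivable_continuous_pt, derivable_pt_pow.
Qed.

(** * Power series determined by a differential equation *)

Lemma CV_radius_of_bounded (a : nat -> R) (x : R) :
  (forall n, Rabs (a n) <= 1) -> Rabs x < 1 ->
  Rbar_lt (Rabs x) (CV_radius a).
Proof.
  intros Ha Hx.
  set (r := (Rabs x + 1) / 2).
  assert (Hr0 : 0 <= r) by (unfold r; assert (H := Rabs_pos x); lra).
  apply (Rbar_lt_le_trans _ (Finite r)); [simpl; unfold r; lra|].
  apply Lub_Rbar_correct.
  unfold CV_disk.
  refine (ex_series_le _ (fun n => r ^ n) _ _).
  - intros n. unfold norm; simpl; unfold abs; simpl.
    rewrite Rabs_Rabsolu, Rabs_mult, (Rabs_pos_eq (r ^ n)) by now apply pow_le.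
    assert (H := Ha n). assert (H' := pow_le r n Hr0). nra.
  - exists (/ (1 - r)). apply is_series_geom.
    rewrite Rabs_pos_eq by exact Hr0. unfold r; lra.
Qed.

(** Serves for series whose convergence at the endpoints is at best conditional,
    such as that of [ln (1 - x)]. *)
Lemma PSeries_eq_on_open (a : nat -> R) (F : R -> R) :
  (forall n, Rabs (a n) <= 1) ->
  F 0 = a O ->
  (forall x, -1 < x < 1 -> is_derive F x (PSeries (PS_derive a) x)) ->
  forall x, -1 < x < 1 -> PSeries a x = F x.
Proof.
  intros Ha H0 HF x Hx.
  assert (HD : forall y, -1 < y < 1 ->
            is_derive (PSeries a) y (PSeries (PS_derive a) y)).
  { intros y Hy. apply is_derive_PSeries, CV_radius_of_bounded; [exact Ha|].
    apply Rabs_def1; lra. }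
  assert (Hin : forall y, Rmin 0 x <= y <= Rmax 0 x -> -1 < y < 1).
  { unfold Rmin, Rmax. intros y Hy. destruct (Rle_dec 0 x); lra. }
  apply (eq_of_equal_derivatives _ _ (PSeries (PS_derive a)) 0 x).
  - intros y Hy. split; [apply HD|apply HF]; apply Hin; lra.
  - intros y Hy. apply Hin in Hy. split.
    + apply (ex_derive_continuous (PSeries a)). eexists. now apply HD.
    + apply (ex_derive_continuous F). eexists. now apply HF.
  - now rewrite PSeries_0.
Qed.

(** The Euler operator [x d/dx] multiplies the [n]-th coefficient by [n].  It
    links [Li_k] to [Li_(k-1)], and the series of [H_(n-1) / n^k] to that of
    [H_(n-1) / n^(k-1)]. *)
Lemma is_derive_PSeries_euler (a b : nat -> R) (x : R) :
  (forall n, Rabs (a n) <= 1) ->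
  (forall n, INR n * a n = b n) ->
  Rabs x < 1 -> x <> 0 ->
  is_derive (PSeries a) x (PSeries b x / x).
Proof.
  intros Ha Hab Hx Hx0.
  replace (PSeries b x / x) with (PSeries (PS_derive a) x).
  - apply is_derive_PSeries. now apply CV_radius_of_bounded.
  - rewrite (PSeries_ext b (PS_incr_1 (PS_derive a))).
    + rewrite PSeries_incr_1. now field.
    + intros [|n]; rewrite <- Hab; simpl; [|reflexivity].
      unfold zero; simpl. ring.
Qed.

(** The way a closed form is obtained for each of the three series that converge
    absolutely at the endpoints.  Continuity of [F] at [-1], together with that
    of the clamped series, carries the equality from the open disk to [-1]. *)
Lemma PSeries_eq_on_halfopen (a b : nat -> R) (F : R -> R) :
  ex_series (fun n => Rabs (a n)) ->
  (forall n, Rabs (a n) <= 1) ->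
  (forall n, INR n * a n = b n) ->
  F 0 = a O ->
  (forall x, x < 1 -> continuous F x) ->
  (forall x, -1 < x < 1 -> x <> 0 -> is_derive F x (PSeries b x / x)) ->
  forall x, -1 <= x < 1 -> PSeries a x = F x.
Proof.
  intros Hs Ha Hab HF0 HFc HFd x Hx.
  rewrite <- (clamp_id x) at 1 by lra.
  apply (eq_of_equal_derivatives (fun y => PSeries a (clamp y)) F
           (fun y => PSeries b y / y) 0 x).
  - intros y Hy. unfold Rmin, Rmax in Hy.
    assert (Hy1 : -1 < y < 1 /\ y <> 0) by (destruct (Rle_dec 0 x); lra).
    destruct Hy1 as [Hy1 Hy0].
    split; [|now apply HFd].
    apply (is_derive_ext_loc (PSeries a)).
    + assert (Hl : locally y (fun z => -1 < z < 1)).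
      { apply (open_and (fun z => -1 < z) (fun z => z < 1)
                 (open_gt (-1)) (open_lt 1)). exact Hy1. }
      revert Hl. apply filter_imp. intros z Hz. now rewrite clamp_id by lra.
    + apply is_derive_PSeries_euler; try assumption. apply Rabs_def1; lra.
  - intros y Hy. unfold Rmin, Rmax in Hy.
    split; [now apply continuous_PSeries_clamp|].
    apply HFc. destruct (Rle_dec 0 x); lra.
  - rewrite clamp_id by lra. now rewrite PSeries_0.
Qed.

(** * Coefficients of the polylogarithms and of the harmonic sums *)

(** The division convention [/ 0 = 0] makes the constant coefficient vanish for
    [k > 0], so that [Li_k] is a power series without a shift of the index. *)
Definition polylog_coeff (k n : nat) : R := / INR n ^ k.

(** The index is that of the power of [t]: [H_n t^(n+1) / (n+1)^2] contributes
    its coefficient at [n + 1], whence the predecessor.  As [harmonic 0 = 0],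
    the constant coefficient vanishes for every [k]. *)
Definition harmonic_coeff (k n : nat) : R := harmonic (pred n) / INR n ^ k.

Lemma harmonic_0 : harmonic 0 = 0.
Proof. apply (sum_n_m_zero (G := R_AbelianMonoid)). lia. Qed.

Lemma harmonic_S (n : nat) : harmonic (S n) = harmonic n + / INR (S n).
Proof. apply (sum_n_Sm (G := R_AbelianMonoid)). lia. Qed.

Lemma INR_S_pos (n : nat) : 0 < INR (S n).
Proof. apply lt_0_INR. lia. Qed.

Lemma INR_S_ge_1 (n : nat) : 1 <= INR (S n).
Proof. rewrite S_INR. assert (H := pos_INR n). lra. Qed.

Lemma harmonic_bounds (n : nat) : 0 <= harmonic n <= INR n.
Proof.
  induction n as [|n IH].
  - rewrite harmonic_0. simpl. lra.
  - rewrite harmonic_S. assert (H := INR_S_ge_1 n).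
    assert (H1 : 0 < / INR (S n)) by (apply Rinv_0_lt_compat; lra).
    assert (H2 : / INR (S n) <= / 1) by (apply Rinv_le_contravar; lra).
    rewrite Rinv_1 in H2. assert (H3 := S_INR n). lra.
Qed.

Lemma Rabs_polylog_coeff (k n : nat) : Rabs (polylog_coeff (S k) n) <= 1.
Proof.
  unfold polylog_coeff. destruct n as [|n].
  - rewrite pow_i, Rinv_0, Rabs_R0 by lia. lra.
  - assert (H := pow_R1_Rle (INR (S n)) (S k) (INR_S_ge_1 n)).
    rewrite Rabs_pos_eq by (left; apply Rinv_0_lt_compat; lra).
    rewrite <- Rinv_1. apply Rinv_le_contravar; lra.
Qed.

Lemma polylog_coeff_euler (k n : nat) :
  INR n * polylog_coeff (S (S k)) n = polylog_coeff (S k) n.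
Proof.
  unfold polylog_coeff. destruct n as [|n].
  - change (INR 0) with 0. now rewrite Rmult_0_l, pow_i, Rinv_0 by lia.
  - assert (H := INR_S_pos n).
    change (INR (S n) ^ S (S k)) with (INR (S n) * INR (S n) ^ S k).
    field. split; [apply pow_nonzero|]; lra.
Qed.

Lemma Rabs_harmonic_coeff (k n : nat) : Rabs (harmonic_coeff (S k) n) <= 1.
Proof.
  unfold harmonic_coeff. destruct n as [|n].
  - simpl pred. rewrite harmonic_0. unfold Rdiv. rewrite Rmult_0_l, Rabs_R0. lra.
  - simpl pred. assert (H := pow_R1_Rle (INR (S n)) k (INR_S_ge_1 n)).
    assert (H1 := harmonic_bounds n). assert (H2 := S_INR n).
    assert (H3 := INR_S_pos n).
    rewrite <- tech_pow_Rmult.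
    assert (H4 : 0 < INR (S n) * INR (S n) ^ k) by nra.
    unfold Rdiv. rewrite Rabs_mult, (Rabs_pos_eq (harmonic n)) by lra.
    rewrite Rabs_pos_eq by (left; apply Rinv_0_lt_compat; lra).
    apply (Rmult_le_reg_r (INR (S n) * INR (S n) ^ k)); [lra|].
    rewrite Rmult_assoc, Rinv_l by lra. nra.
Qed.

Lemma harmonic_coeff_euler (k n : nat) :
  INR n * harmonic_coeff (S k) n = harmonic_coeff k n.
Proof.
  unfold harmonic_coeff. destruct n as [|n].
  - simpl pred. rewrite harmonic_0. simpl INR. unfold Rdiv. ring.
  - assert (H := INR_S_pos n). rewrite <- tech_pow_Rmult.
    field. split; [apply pow_nonzero|]; lra.
Qed.

(** The sequence [u_n = (H_n + 1) / n] decreases by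
    [(H_n + 1) / (n (n+1)) - / (n+1)^2], which is at least [H_n / (n+1)^2]. *)
Lemma ex_series_harmonic_coeff :
  ex_series (fun n => Rabs (harmonic_coeff 2 n)).
Proof.
  apply ex_series_incr_1, ex_series_incr_1.
  apply (ex_series_of_telescoping _ (fun n => (harmonic (S n) + 1) / INR (S n))).
  - intros n. split; [apply Rabs_pos|].
    unfold harmonic_coeff. simpl pred.
    rewrite (harmonic_S (S n)).
    assert (H1 := harmonic_bounds (S n)). assert (H2 := INR_S_pos n).
    rewrite (S_INR (S n)). set (x := INR (S n)) in *. set (h := harmonic (S n)) in *.
    rewrite Rabs_pos_eq.
    + apply Rminus_le_0.
      replace (_ - _) with ((h + 1) / (x * (x + 1) ^ 2)) by (field; lra).
      apply Rdiv_le_0_compat; [lra|]. nra.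
    + apply Rdiv_le_0_compat; [lra|]. nra.
  - intros n. assert (H1 := harmonic_bounds (S n)).
    apply Rdiv_le_0_compat; [lra|apply INR_S_pos].
Qed.

(** Since [/ n^k <= / n^2 <= 2 / n - 2 / (n+1)] for [n >= 1] and [k >= 2]. *)
Lemma ex_series_polylog_coeff (k : nat) :
  ex_series (fun n => Rabs (polylog_coeff (S (S k)) n)).
Proof.
  apply ex_series_incr_1.
  apply (ex_series_of_telescoping _ (fun n => 2 / INR (S n))).
  - intros n. split; [apply Rabs_pos|].
    unfold polylog_coeff. rewrite (S_INR (S n)).
    assert (H1 := INR_S_ge_1 n).
    assert (H2 := pow_R1_Rle (INR (S n)) k H1).
    rewrite <- !tech_pow_Rmult.
    set (x := INR (S n)) in *.
    assert (H3 : x * x <= x * (x * x ^ k)) by nra.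
    rewrite Rabs_pos_eq by (left; apply Rinv_0_lt_compat; nra).
    apply (Rle_trans _ (/ (x * x))); [apply Rinv_le_contravar; nra|].
    apply Rminus_le_0.
    replace (_ - _) with ((x - 1) / (x * x * (x + 1))) by (field; lra).
    apply Rdiv_le_0_compat; [lra|]. nra.
  - intros n. apply Rdiv_le_0_compat; [lra|apply INR_S_pos].
Qed.

(** * Generating functions on the open disk *)

Lemma PSeries_Li1 (x : R) : -1 < x < 1 ->
  PSeries (polylog_coeff 1) x = - ln (1 - x).
Proof.
  apply (PSeries_eq_on_open _ (fun x => - ln (1 - x))).
  - intros n. apply Rabs_polylog_coeff.
  - unfold polylog_coeff. rewrite Rminus_0_r, ln_1. simpl. rewrite Rmult_0_l, Rinv_0. ring.
  - intros y Hy.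
    replace (PSeries _ y) with (/ (1 - y)).
    + auto_derive; [lra|]. field. lra.
    + rewrite <- Series_geom by (apply Rabs_def1; lra).
      apply Series_ext. intros n. unfold PS_derive, polylog_coeff.
      assert (H := INR_S_pos n). rewrite pow_1. field. lra.
Qed.

(** Multiplying by [1 - x] replaces the coefficients [H_n] by the differences
    [H_n - H_(n-1) = / n], which are those of [- ln (1 - x)]. *)
Lemma PSeries_harmonic (x : R) : -1 < x < 1 ->
  PSeries harmonic x = - ln (1 - x) / (1 - x).
Proof.
  intros Hx. rewrite <- PSeries_Li1 by exact Hx.
  assert (HP : forall n, PS_derive (harmonic_coeff 1) n = harmonic n).
  { intros n. unfold PS_derive. rewrite harmonic_coeff_euler.
    unfold harmonic_coeff. simpl. field. }
  assert (Hex : ex_pseries harmonic x).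
  { apply CV_radius_inside. rewrite <- (CV_radius_ext _ _ HP), CV_radius_derive.
    apply CV_radius_of_bounded; [apply Rabs_harmonic_coeff|].
    apply Rabs_def1; lra. }
  rewrite (PSeries_ext (polylog_coeff 1) (PS_minus harmonic (PS_incr_1 harmonic))).
  - rewrite PSeries_minus, PSeries_incr_1; [field; lra|exact Hex|].
    now apply ex_pseries_incr_1.
  - intros [|n].
    + change (polylog_coeff 1 0 = harmonic 0 + - 0).
      rewrite harmonic_0. unfold polylog_coeff. simpl. rewrite Rmult_0_l, Rinv_0. ring.
    + change (polylog_coeff 1 (S n) = harmonic (S n) + - harmonic n).
      rewrite harmonic_S. unfold polylog_coeff. rewrite pow_1. ring.
Qed.

Lemma PSeries_harmonic_coeff_1 (x : R) : -1 < x < 1 ->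
  PSeries (harmonic_coeff 1) x = / 2 * ln (1 - x) ^ 2.
Proof.
  apply (PSeries_eq_on_open _ (fun x => / 2 * ln (1 - x) ^ 2)).
  - intros n. apply Rabs_harmonic_coeff.
  - unfold harmonic_coeff. simpl pred.
    rewrite harmonic_0, Rminus_0_r, ln_1. simpl. unfold Rdiv. ring.
  - intros y Hy.
    rewrite (PSeries_ext _ harmonic).
    + rewrite PSeries_harmonic by exact Hy.
      auto_derive; [lra|]. fold (1 - y). field. lra.
    + intros n. unfold PS_derive. rewrite harmonic_coeff_euler.
      unfold harmonic_coeff. simpl. field.
Qed.

(** * The integral polylogarithms on the half-line below 1 *)

(** Setting the quotient to [F' 0] at [0] removes the singularity. *)
Lemma continuous_slope (F : R -> R) (l : R) :
  F 0 = 0 -> is_derive F 0 l ->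
  (forall x, x < 1 -> continuous F x) ->
  forall x, x < 1 ->
    continuous (fun y => if Req_dec_T y 0 then l else F y / y) x.
Proof.
  intros HF0 Hd Hc x Hx.
  destruct (Req_dec_T x 0) as [->|Hx0].
  - intros P HP. cbv beta in HP.
    destruct (Req_dec_T 0 0) as [_|n]; [|now elim n].
    destruct HP as [eps HP].
    apply is_derive_Reals in Hd.
    destruct (Hd eps (cond_pos eps)) as [d Hd'].
    exists d. intros y Hy. change (Rabs (y - 0) < d) in Hy.
    apply HP. destruct (Req_dec_T y 0) as [_|Hy0]; [apply ball_center|].
    rewrite Rminus_0_r in Hy.
    specialize (Hd' y Hy0 Hy). rewrite Rplus_0_l, HF0, Rminus_0_r in Hd'.
    exact Hd'.
  - apply (continuous_ext_loc _ (fun y => F y / y)).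
    + assert (Hl : locally x (fun y => y <> 0)) by now apply open_neq.
      revert Hl. apply filter_imp. intros y Hy.
      now destruct (Req_dec_T y 0).
    + apply (continuous_mult F Rinv); [now apply Hc|].
      now apply continuous_Rinv.
Qed.

(** The integrand may be replaced by its continuous extension, because [0] is an
    endpoint of the interval of integration.  The derivative at [0] is part of
    the statement so that the lemma can be iterated: for [Li2_integral] it
    provides the slope at [0] required to treat [Li3_integral]. *)
Lemma is_derive_RInt_quotient (F : R -> R) (l : R) :
  F 0 = 0 -> is_derive F 0 l ->
  (forall x, x < 1 -> continuous F x) ->
  forall x, x < 1 ->
    is_derive (fun u => RInt (fun v => F v / v) 0 u) x
      (if Req_dec_T x 0 then l else F x / x).
Proof.
  intros HF0 Hd Hc x Hx.
  set (g := fun y => if Req_dec_T y 0 then l else F y / y).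
  assert (Hg : forall y, y < 1 -> continuous g y)
    by now apply continuous_slope.
  apply (is_derive_ext (fun u => RInt g 0 u)).
  - intros u. apply RInt_ext. intros y Hy. unfold g.
    destruct (Req_dec_T y 0) as [->|_]; [|reflexivity].
    unfold Rmin, Rmax in Hy. destruct (Rle_dec 0 u); lra.
  - apply (is_derive_RInt g _ 0 x); [|now apply Hg].
    assert (Hl : locally x (fun y => y < 1)) by now apply open_lt.
    revert Hl. apply filter_imp. intros u Hu.
    apply (RInt_correct (V := R_CompleteNormedModule) g).
    apply (ex_RInt_continuous g). intros z Hz. apply Hg.
    unfold Rmax in Hz. destruct (Rle_dec 0 u); lra.
Qed.

Lemma continuous_log (x : R) : x < 1 -> continuous (fun y => ln (1 - y)) x.
Proof.
  intros Hx. apply (ex_derive_continuous (fun y => ln (1 - y))).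
  auto_derive. lra.
Qed.

Lemma Li2_integral_0 : Li2_integral 0 = 0.
Proof.
  unfold Li2_integral. rewrite (RInt_point (V := R_CompleteNormedModule)).
  unfold zero; simpl. ring.
Qed.

Lemma Li3_integral_0 : Li3_integral 0 = 0.
Proof.
  unfold Li3_integral. now rewrite (RInt_point (V := R_CompleteNormedModule)).
Qed.

Lemma is_derive_Li2_integral_full (x : R) : x < 1 ->
  is_derive Li2_integral x (if Req_dec_T x 0 then 1 else - ln (1 - x) / x).
Proof.
  intros Hx.
  assert (Hd : is_derive (fun v => ln (1 - v)) 0 (-1))
    by (auto_derive; [lra|]; field).
  assert (H0 : ln (1 - 0) = 0) by now rewrite Rminus_0_r, ln_1.
  assert (H := is_derive_RInt_quotient (fun v => ln (1 - v)) (-1)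
                 H0 Hd continuous_log x Hx).
  refine (eq_rect _ (is_derive Li2_integral x) (is_derive_opp _ _ _ H) _ _).
  unfold opp; simpl. destruct (Req_dec_T x 0); [ring|now field].
Qed.

Lemma is_derive_Li2_integral (x : R) : x < 1 -> x <> 0 ->
  is_derive Li2_integral x (- ln (1 - x) / x).
Proof.
  intros Hx Hx0. assert (H := is_derive_Li2_integral_full x Hx).
  now destruct (Req_dec_T x 0).
Qed.

Lemma continuous_Li2_integral (x : R) : x < 1 -> continuous Li2_integral x.
Proof.
  intros Hx. apply (ex_derive_continuous Li2_integral).
  eexists. now apply is_derive_Li2_integral_full.
Qed.

Lemma is_derive_Li3_integral_full (x : R) : x < 1 ->
  is_derive Li3_integral x (if Req_dec_T x 0 then 1 else Li2_integral x / x).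
Proof.
  apply (is_derive_RInt_quotient Li2_integral 1).
  - exact Li2_integral_0.
  - assert (H := is_derive_Li2_integral_full 0 Rlt_0_1).
    now destruct (Req_dec_T 0 0).
  - exact continuous_Li2_integral.
Qed.

Lemma is_derive_Li3_integral (x : R) : x < 1 -> x <> 0 ->
  is_derive Li3_integral x (Li2_integral x / x).
Proof.
  intros Hx Hx0. assert (H := is_derive_Li3_integral_full x Hx).
  now destruct (Req_dec_T x 0).
Qed.

Lemma continuous_Li3_integral (x : R) : x < 1 -> continuous Li3_integral x.
Proof.
  intros Hx. apply (ex_derive_continuous Li3_integral).
  eexists. now apply is_derive_Li3_integral_full.
Qed.

(** * Agreement of the series with the integrals *)

Lemma PSeries_Li2 (x : R) : -1 <= x < 1 ->
  PSeries (polylog_coeff 2) x = Li2_integral x.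
Proof.
  apply (PSeries_eq_on_halfopen _ (polylog_coeff 1)).
  - apply ex_series_polylog_coeff.
  - apply Rabs_polylog_coeff.
  - apply polylog_coeff_euler.
  - rewrite Li2_integral_0. unfold polylog_coeff.
    now rewrite pow_i, Rinv_0 by lia.
  - exact continuous_Li2_integral.
  - intros y Hy Hy0. rewrite PSeries_Li1 by exact Hy.
    apply is_derive_Li2_integral; lra.
Qed.

Lemma PSeries_Li3 (x : R) : -1 <= x < 1 ->
  PSeries (polylog_coeff 3) x = Li3_integral x.
Proof.
  apply (PSeries_eq_on_halfopen _ (polylog_coeff 2)).
  - apply ex_series_polylog_coeff.
  - apply Rabs_polylog_coeff.
  - apply polylog_coeff_euler.
  - rewrite Li3_integral_0. unfold polylog_coeff.
    now rewrite pow_i, Rinv_0 by lia.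
  - exact continuous_Li3_integral.
  - intros y Hy Hy0. rewrite PSeries_Li2 by lra.
    apply is_derive_Li3_integral; lra.
Qed.

Lemma Series_polylog (k : nat) (x : R) : Rabs x <= 1 ->
  Series (fun n => x ^ (n + 1) / INR (n + 1) ^ S (S k))
  = PSeries (polylog_coeff (S (S k))) x.
Proof.
  intros Hx. unfold PSeries. rewrite (Series_incr_1 (fun n => _ * _)).
  - unfold polylog_coeff at 1. rewrite pow_i, Rinv_0, Rmult_0_l, Rplus_0_l by lia.
    apply Series_ext. intros n. rewrite Nat.add_1_r.
    unfold polylog_coeff. apply Rmult_comm.
  - apply ex_series_PSeries_closed; [apply ex_series_polylog_coeff|exact Hx].
Qed.

Lemma Li2_eq_integral (x : R) : x < 1 -> Li2 x = Li2_integral x.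
Proof.
  intros Hx. unfold Li2. destruct (Rle_dec (Rabs x) 1) as [H|_]; [|reflexivity].
  rewrite (Series_polylog 0) by exact H.
  apply PSeries_Li2. apply Rabs_le_between in H. lra.
Qed.

Lemma Li3_eq_integral (x : R) : x < 1 -> Li3 x = Li3_integral x.
Proof.
  intros Hx. unfold Li3. destruct (Rle_dec (Rabs x) 1) as [H|_]; [|reflexivity].
  rewrite (Series_polylog 1) by exact H.
  apply PSeries_Li3. apply Rabs_le_between in H. lra.
Qed.

(** * Landen's identity *)

Lemma landen_arg_lt_1 (t : R) : t < 1 -> - t / (1 - t) < 1.
Proof.
  intros Ht. apply Rlt_0_minus.
  replace (1 - - t / (1 - t)) with (/ (1 - t)) by (field; lra).
  apply Rinv_0_lt_compat. lra.
Qed.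

Lemma landen_arg_neq_0 (t : R) : t < 1 -> t <> 0 -> - t / (1 - t) <> 0.
Proof.
  intros Ht H0 H. apply H0.
  replace t with (- (- t / (1 - t)) * (1 - t)) by (field; lra).
  rewrite H. ring.
Qed.

Lemma is_derive_landen_arg (t : R) : t < 1 ->
  is_derive (fun u => - u / (1 - u)) t (- / (1 - t) ^ 2).
Proof. intros Ht. auto_derive; [lra|]. field. lra. Qed.

Lemma ln_landen_arg (t : R) : t < 1 -> ln (1 - - t / (1 - t)) = - ln (1 - t).
Proof.
  intros Ht.
  replace (1 - - t / (1 - t)) with (/ (1 - t)) by (field; lra).
  apply ln_Rinv. lra.
Qed.

Lemma continuous_comp_landen_arg (F : R -> R) (t : R) :
  (forall x, x < 1 -> continuous F x) -> t < 1 ->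
  continuous (fun u => F (- u / (1 - u))) t.
Proof.
  intros HF Ht. apply (continuous_comp (fun u => - u / (1 - u)) F).
  - apply (ex_derive_continuous (fun u => - u / (1 - u))).
    eexists. now apply is_derive_landen_arg.
  - now apply HF, landen_arg_lt_1.
Qed.

(** Both sides vanish at [0] and have derivative [ln (1-t) / (t (1-t))]: on the
    left because [1 - y = / (1-t)] and [dy/y = dt / (t (1-t))] for
    [y = - t / (1-t)], on the right because
    [/ t + / (1-t) = / (t (1-t))]. *)
Lemma landen_Li2 (t : R) : t < 1 ->
  Li2_integral (- t / (1 - t)) = - Li2_integral t - / 2 * ln (1 - t) ^ 2.
Proof.
  intros Ht.
  assert (HL : forall x, x < 1 ->
      is_derive (fun u => / 2 * ln (1 - u) ^ 2) x (- ln (1 - x) / (1 - x))).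
  { intros x Hx. auto_derive; [lra|]. fold (1 - x). field. lra. }
  assert (Hin : forall y, Rmin 0 t <= y <= Rmax 0 t -> y < 1).
  { unfold Rmax. intros y Hy. destruct (Rle_dec 0 t); lra. }
  apply (eq_of_equal_derivatives (fun u => Li2_integral (- u / (1 - u)))
    (fun u => - Li2_integral u - / 2 * ln (1 - u) ^ 2)
    (fun u => ln (1 - u) / (u * (1 - u))) 0 t).
  - intros y Hy.
    assert (Hy1 : y < 1) by (apply Hin; lra).
    assert (Hy0 : y <> 0)
      by (unfold Rmin, Rmax in Hy; destruct (Rle_dec 0 t); lra).
    split.
    + replace (ln (1 - y) / (y * (1 - y))) with
        (scal (- / (1 - y) ^ 2)
           (- ln (1 - - y / (1 - y)) / (- y / (1 - y)))).
      * apply (is_derive_comp Li2_integral (fun u => - u / (1 - u))).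
        -- apply is_derive_Li2_integral;
             [now apply landen_arg_lt_1|now apply landen_arg_neq_0].
        -- now apply is_derive_landen_arg.
      * rewrite ln_landen_arg by exact Hy1.
        unfold scal; simpl; unfold mult; simpl. field. lra.
    + replace (ln (1 - y) / (y * (1 - y))) with
        (minus (opp (- ln (1 - y) / y)) (- ln (1 - y) / (1 - y)))
        by (unfold minus, opp, plus; simpl; field; lra).
      apply (is_derive_minus (fun u => - Li2_integral u)
               (fun u => / 2 * ln (1 - u) ^ 2)).
      * apply (is_derive_opp Li2_integral). now apply is_derive_Li2_integral.
      * now apply HL.
  - intros y Hy. apply Hin in Hy. split.
    + apply (continuous_comp_landen_arg Li2_integral);
        [exact continuous_Li2_integral|exact Hy].
    + apply (continuous_minus (fun u => - Li2_integral u)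
               (fun u => / 2 * ln (1 - u) ^ 2)).
      * apply (continuous_opp Li2_integral). now apply continuous_Li2_integral.
      * apply (ex_derive_continuous (fun u => / 2 * ln (1 - u) ^ 2)).
        eexists. now apply HL.
  - rewrite Rminus_0_r, Ropp_0, ln_1. unfold Rdiv.
    rewrite Rmult_0_l, Li2_integral_0. ring.
Qed.

(** * The harmonic sum *)

Definition harmonic_sum_rhs (t : R) : R :=
  Li3_integral (- t / (1 - t)) - / 6 * ln (1 - t) ^ 3
  - ln (1 - t) * Li2_integral t + Li3_integral t.

(** After Landen's identity the coefficient of [Li2_integral t] is
    [- / (t (1-t)) + / (1-t) + / t = 0], and that of [ln (1-t)^2] is
    [- / (2 t (1-t)) + / (2 (1-t)) + / t = / (2 t)]. *)
Lemma is_derive_harmonic_sum_rhs (t : R) : t < 1 -> t <> 0 ->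
  is_derive harmonic_sum_rhs t (/ 2 * ln (1 - t) ^ 2 / t).
Proof.
  intros Ht Ht0.
  assert (H1 : is_derive (fun u => Li3_integral (- u / (1 - u))) t
            ((- / (1 - t) ^ 2) *
             (Li2_integral (- t / (1 - t)) / (- t / (1 - t))))).
  { apply (is_derive_comp Li3_integral (fun u => - u / (1 - u))).
    - apply is_derive_Li3_integral;
        [now apply landen_arg_lt_1|now apply landen_arg_neq_0].
    - now apply is_derive_landen_arg. }
  assert (H2 : is_derive (fun u => / 6 * ln (1 - u) ^ 3) t
            (- / 2 * ln (1 - t) ^ 2 / (1 - t))).
  { auto_derive; [lra|]. fold (1 - t). field. lra. }
  assert (H3 : is_derive (fun u => ln (1 - u)) t (- / (1 - t))).
  { auto_derive; [lra|]. field. lra. }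
  assert (H4 := is_derive_Li2_integral t Ht Ht0).
  assert (H5 := is_derive_mult (fun u => ln (1 - u)) Li2_integral t _ _ H3 H4
                  Rmult_comm).
  assert (H6 := is_derive_Li3_integral t Ht Ht0).
  assert (H7 := is_derive_plus _ _ _ _ _
    (is_derive_minus _ _ _ _ _ (is_derive_minus _ _ _ _ _ H1 H2) H5) H6).
  rewrite landen_Li2 in H7 by exact Ht.
  refine (eq_rect _ (is_derive harmonic_sum_rhs t) H7 _ _).
  unfold minus, plus, opp, mult; simpl. field. lra.
Qed.

Lemma continuous_harmonic_sum_rhs (t : R) : t < 1 ->
  continuous harmonic_sum_rhs t.
Proof.
  intros Ht.
  apply (continuous_plus (fun u => Li3_integral (- u / (1 - u))
           - / 6 * ln (1 - u) ^ 3 - ln (1 - u) * Li2_integral u) Li3_integral);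
    [|now apply continuous_Li3_integral].
  apply (continuous_minus (fun u => Li3_integral (- u / (1 - u))
           - / 6 * ln (1 - u) ^ 3) (fun u => ln (1 - u) * Li2_integral u)).
  - apply (continuous_minus (fun u => Li3_integral (- u / (1 - u)))
             (fun u => / 6 * ln (1 - u) ^ 3)).
    + apply (continuous_comp_landen_arg Li3_integral);
        [exact continuous_Li3_integral|exact Ht].
    + apply (ex_derive_continuous (fun u => / 6 * ln (1 - u) ^ 3)).
      auto_derive. lra.
  - apply (continuous_mult (fun u => ln (1 - u)) Li2_integral);
      [now apply continuous_log|now apply continuous_Li2_integral].
Qed.

Lemma PSeries_harmonic_coeff_2 (t : R) : -1 <= t < 1 ->
  PSeries (harmonic_coeff 2) t = harmonic_sum_rhs t.
Proof.
  apply (PSeries_eq_on_halfopen _ (harmonic_coeff 1)).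
  - exact ex_series_harmonic_coeff.
  - apply Rabs_harmonic_coeff.
  - apply harmonic_coeff_euler.
  - unfold harmonic_sum_rhs, harmonic_coeff. simpl pred.
    rewrite harmonic_0, Rminus_0_r, Ropp_0, ln_1. unfold Rdiv.
    rewrite !Rmult_0_l, Li3_integral_0. ring.
  - exact continuous_harmonic_sum_rhs.
  - intros y Hy Hy0. rewrite PSeries_harmonic_coeff_1 by exact Hy.
    apply is_derive_harmonic_sum_rhs; lra.
Qed.

Lemma is_series_harmonic_terms (t : R) : Rabs t <= 1 ->
  is_series (fun k => harmonic (k + 1) * (t ^ (k + 1 + 1) / INR (k + 1 + 1) ^ 2))
            (PSeries (harmonic_coeff 2) t).
Proof.
  intros Ht.
  assert (H := Series_correct _
    (ex_series_PSeries_closed _ t ex_series_harmonic_coeff Ht)).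
  change (is_series (fun n => harmonic_coeff 2 n * t ^ n)
            (PSeries (harmonic_coeff 2) t)) in H.
  apply (is_series_ext
           (fun k => harmonic_coeff 2 (S (S k)) * t ^ (S (S k)))).
  - intros k. rewrite !Nat.add_1_r.
    change (harmonic (S k) / INR (S (S k)) ^ 2 * t ^ S (S k)
            = harmonic (S k) * (t ^ S (S k) / INR (S (S k)) ^ 2)).
    unfold Rdiv. ring.
  (* The harmonic sum starts at [t^2]; the coefficients before it are zero. *)
  - apply (is_series_incr_1 (fun k => harmonic_coeff 2 (S k) * t ^ (S k))).
    apply (is_series_incr_1 (fun k => harmonic_coeff 2 k * t ^ k)).
    assert (Hz : forall m, pred m = O -> harmonic_coeff 2 m = 0).
    { intros m Hm. unfold harmonic_coeff. rewrite Hm, harmonic_0.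
      unfold Rdiv. ring. }
    rewrite (Hz 0%nat), (Hz 1%nat), !Rmult_0_l by reflexivity.
    unfold plus; simpl. rewrite !Rplus_0_r. exact H.
Qed.

Theorem proposition1 :
  let term := fun (t : R) (n : nat) =>
    harmonic n * (t ^ (n + 1) / INR (n + 1) ^ 2) in
  let rhs := fun t : R =>
    Li3 (- t / (1 - t)) - / 6 * ln (1 - t) ^ 3 - ln (1 - t) * Li2 t + Li3 t in
  forall t : R, -1 <= t <= 1 ->
    (t < 1 -> is_series (fun k : nat => term t (k + 1)%nat) (rhs t)) /\
    (t = 1 -> exists L : R,
       filterlim rhs (at_left 1) (locally L) /\
       is_series (fun k : nat => term t (k + 1)%nat) L).
Proof.
  intros term rhs t Ht.
  assert (Hrhs : forall s, -1 <= s < 1 -> PSeries (harmonic_coeff 2) s = rhs s).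
  { intros s Hs. rewrite PSeries_harmonic_coeff_2 by exact Hs.
    unfold rhs, harmonic_sum_rhs.
    rewrite Li2_eq_integral, !Li3_eq_integral; try lra.
    apply landen_arg_lt_1. lra. }
  assert (Hsum := is_series_harmonic_terms t ltac:(apply Rabs_le; lra)).
  split.
  - intros Ht1. rewrite <- Hrhs by lra. exact Hsum.
  - intros ->. exists (PSeries (harmonic_coeff 2) 1). split; [|exact Hsum].
    apply (filterlim_ext_loc (fun s => PSeries (harmonic_coeff 2) (clamp s))).
    + assert (Hl : locally 1 (fun s : R => -1 < s)) by (apply open_gt; lra).
      unfold at_left, within. revert Hl. apply filter_imp.
      intros s Hs Hs1. rewrite clamp_id by lra. apply Hrhs. lra.
    + assert (Hc := continuous_PSeries_clamp _ ex_series_harmonic_coeff 1).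
      unfold continuous in Hc. rewrite (clamp_id 1) in Hc by lra.
      intros P HP. specialize (Hc P HP). revert Hc.
      unfold filtermap, at_left, within.
      apply filter_imp. intros s Hs _. exact Hs.
Qed.
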